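(* Let $H\in(\tfrac12,1)$ and, for integers $k\ge 0$, let $$\rho_k=\tfrac12\left(|k+1|^{2H}-2|k|^{2H}+|k-1|^{2H}\right).$$ Then the sequence $\{\rho_k,\ k\ge 0\}$ has the following properties. (1) Monotonicity and positivity: for every integer $k\ge 1$, $\rho_{k-1}>\rho_k>0$. (2) Convexity: for every integer $k\ge 1$, $\rho_{k-1}-\rho_k>\rho_k-\rho_{k+1}$. (3) Log-convexity: for every integer $k\ge 1$, $\rho_{k-1}\rho_{k+1}>\rho_k^2$.
   Context: $\rho_k$ is the autocovariance function of fractional Gaussian noise with Hurst index $H$; in particular $\rho_0=1$. *)

(* Defs.v *)
From HB Require Import structures.
From mathcomp Require Import all_boot all_order all_algebra.
From mathcomp Require Import all_classical all_reals all_analysis.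
Set Implicit Arguments.
Unset Strict Implicit.
Unset Printing Implicit Defensive.
Import Order.TTheory GRing.Theory Num.Theory.

Local Open Scope ring_scope.

(* Autocovariance at lag k of fractional Gaussian noise with Hurst index H.
   The subtraction k%:R - 1 takes place in R, so |k - 1| = 1 at k = 0, and
   powR satisfies 0 `^ a = 0 for a != 0, so |0|^(2H) = 0 as usual. *)
Definition fgn_autocov (R : realType) (H : R) (k : nat) : R :=
  2^-1 * (`|k%:R + 1| `^ (2 * H) - 2 * `|k%:R| `^ (2 * H)
          + `|k%:R - 1| `^ (2 * H)).

(* Main.v *)
(* Put a = 2H, so that 2 rho_k is the second difference at k of x |-> |x|^a.  For
   k >= 1, a linear combination c0 rho_k + c1 rho_(k+1) + c2 rho_(k+2) is half the
   second difference at k of c0 x^a + c1 (x+1)^a + c2 (x+2)^a, hence positive as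
   soon as c0 p^(a-2) + c1 (p+1)^(a-2) + c2 (p+2)^(a-2) > 0 for all p > 0.
   Positivity, monotonicity and log-convexity then come from the power p^(a-2)
   being positive, decreasing and log-convex, and convexity follows from
   log-convexity by AM-GM.  At lag 0, log-convexity amounts to rho_3 < rho_1. *)
Require Import Defs.
From HB Require Import structures.
From mathcomp Require Import all_boot all_order all_algebra.
From mathcomp Require Import all_classical all_reals all_analysis.
From mathcomp Require Import lra ring.
Set Implicit Arguments.
Unset Strict Implicit.
Unset Printing Implicit Defensive.
Import Order.TTheory GRing.Theory Num.Theory.
Import numFieldNormedType.Exports.

Local Open Scope ring_scope.

Lemma is_derive1_shift_comp (R : realType) (f : R -> R) (k x d : R) :
  is_derive (x + k) 1 f d -> is_derive x 1 (fun y => f (y + k)) d.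
Proof.
move=> fd; have sd := is_derive_shift x 1 k.
by rewrite -(mulr1 d); apply: (@is_derive1_comp _ f (shift k)).
Qed.

Lemma continuous_shift_comp (R : realType) (f : R -> R) (k : R) :
  continuous f -> continuous (fun y => f (y + k)).
Proof.
move=> fC y; have : continuous (f \o shift k); last exact.
move=> z; apply: continuous_comp; last exact: fC.
by apply: cvgD; [exact: cvg_id|exact: cvg_cst].
Qed.

(** Two applications of the mean value theorem turn the second difference into a value of [ddf].
    Derivatives are asked for on the open interval only: at lag 1 its left end is 0, where |x|^a may
    fail to be twice differentiable. *)
Lemma second_difference_gt0 (R : realType) (f df ddf : R -> R) (x : R) :
  continuous f ->
  (forall y, y \in `]x - 1, x + 1[ -> is_derive y 1 f (df y)) ->
  (forall y, y \in `]x - 1, x + 1[ -> is_derive y 1 df (ddf y)) ->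
  (forall y, y \in `]x - 1, x + 1[ -> 0 < ddf y) ->
  0 < f (x + 1) - 2 * f x + f (x - 1).
Proof.
move=> fC fdf dfddf ddf_gt0.
pose g y := f (y + 1) - f y.
have itvE y : y \in `]x - 1, x + 1[ = (x - 1 < y < x + 1) by rewrite in_itv.
have gdg y : y \in `]x - 1, x[ -> is_derive y 1 g (df (y + 1) - df y).
  rewrite in_itv/= => /andP[y1 y2].
  apply: is_deriveB; last by apply: fdf; rewrite itvE; lra.
  by apply/is_derive1_shift_comp/fdf; rewrite itvE; lra.
have gC : continuous g.
  move=> y; apply: continuousB; last exact: fC.
  exact: continuous_shift_comp.
have [||c] := MVT _ gdg; [by lra|exact: continuous_subspaceT|].
rewrite in_itv/= => /andP[c1 c2] gc.
(* As [c] lies strictly between [x - 1] and [x], this closed interval avoids both endpoints, so [df]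
   is continuous on it. *)
have sub y : y \in `[c, c + 1] -> y \in `]x - 1, x + 1[.
  by rewrite itvE in_itv/= => /andP[? ?]; lra.
have dfc y : y \in `]c, c + 1[ -> is_derive y 1 df (ddf y).
  by move=> yc; apply/dfddf/sub/subset_itv_oo_cc.
have dfC : {within `[c, c + 1], continuous df}%classic.
  apply: derivable_within_continuous => y /sub yc.
  exact: (@ex_derive _ _ _ _ _ _ _ (dfddf _ yc)).
have [|e ec dfe] := MVT _ dfc dfC; first by rewrite ltrDl.
have e_gt0 : 0 < ddf e by apply/ddf_gt0/sub/subset_itv_oo_cc.
have := gc; rewrite /g dfe subrK. lra.
Qed.

Lemma continuous_powR_norm (R : realType) (a : R) :
  1 <= a -> continuous (fun x : R => `|x| `^ a).
Proof.
move=> a_ge1 x; have [->|x0] := eqVneq x 0.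
  rewrite /continuous_at normr0 powR0; last by lra.
  (* For |y| <= 1 and a >= 1, |y|^a lies between 0 and |y|. *)
  apply: (@squeeze_cvgr _ (nbhs (0 : R)) _ _ (fun=> 0) (fun y : R => `|y|)).
  - near=> y; rewrite powR_ge0/=.
    have [->|y0] := eqVneq y 0; first by rewrite normr0 powR0//; lra.
    apply: ge1r_powR => //; rewrite normr_gt0 y0/=.
    near: y; exact: (@nbhs0_le R R 1 ltr01).
  - exact: cvg_cst.
  - by have := @norm_continuous R R 0; rewrite /continuous_at normr0.
apply: (@continuous_comp _ _ _ (fun y : R => `|y|) (fun y => y `^ a)).
  exact: norm_continuous.
apply/differentiable_continuous; rewrite -derivable1_diffP.
by apply: derivable_powR; rewrite in_itv/= andbT normr_gt0.
Unshelve. all: by end_near. Qed.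

Lemma is_derive1_powR_norm (R : realType) (a x : R) :
  0 < x -> is_derive x 1 (fun y : R => `|y| `^ a) (a * x `^ (a - 1)).
Proof.
move=> x0; apply: near_eq_is_derive; last exact: is_derive1_powR.
near=> y; rewrite ger0_norm// ltW//; near: y; exact: lt_nbhsr.
Unshelve. all: by end_near. Qed.

(** Here [p] ranges over the positive reals because the mean value theorem yields an unspecified
    point of (k - 1, k + 1). *)
Lemma fgn_autocov_comb_gt0 (R : realType) (H c0 c1 c2 : R) (k : nat) :
  2^-1 < H -> (1 <= k)%N ->
  (forall p : R, 0 < p ->
    0 < c0 * p `^ (2 * H - 2) + c1 * (p + 1) `^ (2 * H - 2)
        + c2 * (p + 2) `^ (2 * H - 2)) ->
  0 < c0 * fgn_autocov H k + c1 * fgn_autocov H k.+1 + c2 * fgn_autocov H k.+2.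
Proof.
move=> H_gt k_gt0 c_gt0; set a := 2 * H in c_gt0 *.
have a_gt1 : 1 < a by rewrite /a; lra.
have k1 : 1 <= k%:R :> R by rewrite ler1n.
pose comb (g : R -> R) y := c0 * g y + c1 * g (y + 1) + c2 * g (y + 2).
have combD (g dg : R -> R) (y : R) : 0 < y ->
    (forall z : R, 0 < z -> is_derive z 1 g (dg z)) ->
    is_derive y 1 (comb g) (comb dg y).
  move=> y0 gdg; apply: is_deriveD; [apply: is_deriveD|];
    apply: is_deriveZ.
  - exact: gdg.
  - by apply/is_derive1_shift_comp/gdg; lra.
  - by apply/is_derive1_shift_comp/gdg; lra.
pose f := comb (fun y => `|y| `^ a).
pose df := comb (fun y => a * y `^ (a - 1)).
pose ddf := comb (fun y => a * ((a - 1) * y `^ (a - 2))).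
(* The bound k >= 1 keeps the whole interval in the positive half-line. *)
have pos (y : R) : y \in `]k%:R - 1, k%:R + 1[ -> 0 < y.
  by rewrite in_itv/= => /andP[? ?]; lra.
have := @second_difference_gt0 _ f df ddf k%:R.
rewrite /fgn_autocov -/a.
have -> : c0 * (2^-1 * (`|k%:R + 1| `^ a - 2 * `|k%:R| `^ a + `|k%:R - 1| `^ a)) +
  c1 * (2^-1 * (`|k.+1%:R + 1| `^ a - 2 * `|k.+1%:R| `^ a + `|k.+1%:R - 1| `^ a)) +
  c2 * (2^-1 * (`|k.+2%:R + 1| `^ a - 2 * `|k.+2%:R| `^ a + `|k.+2%:R - 1| `^ a))
  = 2^-1 * (f (k%:R + 1) - 2 * f k%:R + f (k%:R - 1)).
  have e1 : k.+1%:R = k%:R + 1 :> R by rewrite -addn1 natrD.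
  have e2 : k.+2%:R = k%:R + 2 :> R by rewrite -addn2 natrD.
  rewrite /f /comb e1 e2 addrK.
  have -> : k%:R + 1 + 1 = k%:R + 2 :> R by ring.
  have -> : k%:R + 1 + 2 = k%:R + 2 + 1 :> R by ring.
  have -> : k%:R - 1 + 1 = k%:R :> R by ring.
  have -> : k%:R - 1 + 2 = k%:R + 1 :> R by ring.
  have -> : k%:R + 2 - 1 = k%:R + 1 :> R by ring.
  ring.
rewrite pmulr_rgt0 ?invr_gt0//; apply.
- have combC j : continuous (fun y : R => `|y + j| `^ a).
    apply: (@continuous_shift_comp _ (fun y => `|y| `^ a)).
    by apply: continuous_powR_norm; lra.
  move=> y; rewrite /f /comb /continuous_at.
  apply: cvgD; [apply: cvgD|]; apply: cvgM; try exact: cvg_cst; try exact: combC.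
  by apply: continuous_powR_norm; lra.
- by move=> y /pos y0; apply: combD => // z z0; exact: is_derive1_powR_norm.
- move=> y /pos y0; apply: combD => // z z0; apply: is_deriveZ.
  have -> : a - 2 = a - 1 - 1 by ring.
  exact: is_derive1_powR.
- move=> y /pos y0; have := c_gt0 _ y0; rewrite /ddf /comb => cy.
  have -> : forall u v w, c0 * (a * ((a - 1) * u)) + c1 * (a * ((a - 1) * v))
    + c2 * (a * ((a - 1) * w)) = a * (a - 1) * (c0 * u + c1 * v + c2 * w).
    by move=> u v w; ring.
  by rewrite !mulr_gt0//; lra.
Qed.

Lemma ltr_npowR (R : realType) (b p q : R) : b < 0 -> 0 < p -> p < q ->
  q `^ b < p `^ b.
Proof.
move=> b0 p0 pq; have q0 := lt_trans p0 pq.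
rewrite -(opprK b) !(powRN _ (- b)) ltf_pV2 ?posrE ?powR_gt0//.
by rewrite gt0_ltr_powR ?nnegrE ?oppr_gt0 ?ltW.
Qed.

Lemma fgn_autocov0 (R : realType) (H : R) : H != 0 -> fgn_autocov H 0 = 1.
Proof.
move=> H_neq0.
have H0 : 2 * H != 0 by rewrite mulf_neq0// pnatr_eq0.
by rewrite /fgn_autocov add0r sub0r normrN normr1 normr0 powR1 powR0//; lra.
Qed.

Lemma fgn_autocov_gt0 (R : realType) (H : R) (k : nat) :
  2^-1 < H -> 0 < fgn_autocov H k.
Proof.
move=> H_gt; have H_neq0 : H != 0 by lra.
case: k => [|k]; first by rewrite fgn_autocov0.
have := @fgn_autocov_comb_gt0 _ H 1 0 0 k.+1 H_gt isT.
rewrite mul1r !mul0r !addr0; apply => p p0.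
by rewrite mul1r !mul0r !addr0 powR_gt0.
Qed.

Lemma fgn_autocov1 (R : realType) (H : R) :
  H != 0 -> fgn_autocov H 1 = 2^-1 * (2 `^ (2 * H) - 2).
Proof.
move=> H_neq0.
have H0 : 2 * H != 0 by rewrite mulf_neq0// pnatr_eq0.
by rewrite /fgn_autocov subrr normr1 normr0 powR1 powR0// addr0 mulr1 ger0_norm.
Qed.

Lemma fgn_autocov_decr (R : realType) (H : R) (k : nat) :
  2^-1 < H -> H < 1 -> fgn_autocov H k.+1 < fgn_autocov H k.
Proof.
move=> H_gt H_lt; have H_neq0 : H != 0 by lra.
case: k => [|k].
  rewrite fgn_autocov0// fgn_autocov1//.
  (* At lag 0 the claim reads 2^(2H) < 4. *)
  have : 2 `^ (2 * H) < 2 `^ 2%:R :> R.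
    rewrite /powR pnatr_eq0/= ltr_expR ltr_pM2r ?ln_gt0//; lra.
  rewrite powR_mulrn//; lra.
have := @fgn_autocov_comb_gt0 _ H 1 (-1) 0 k.+1 H_gt isT.
rewrite mul1r !mul0r mulN1r !addr0 subr_gt0; apply => p p0.
by rewrite mul1r !mul0r mulN1r !addr0 subr_gt0 ltr_npowR ?ltrDl//; lra.
Qed.

(** A discriminant argument: for k >= 1, a quadratic in [l] with coefficients p^(a-2), (p+1)^(a-2),
    (p+2)^(a-2) is positive for every p > 0, hence so is the one with three consecutive
    autocovariances; its minimum gives the claim. *)
Lemma fgn_autocov_logconvex (R : realType) (H : R) (k : nat) :
  2^-1 < H -> H < 1 ->
  fgn_autocov H k.+1 ^+ 2 < fgn_autocov H k * fgn_autocov H k.+2.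
Proof.
move=> H_gt H_lt; have H_neq0 : H != 0 by lra.
case: k => [|k].
  (* [rho 0 * rho 2 > rho 1 ^+ 2] reads [2 * 3 `^ a > 4 `^ a + 2], and so does
     [rho 3 < rho 1]. *)
  have := lt_trans (fgn_autocov_decr 2 H_gt H_lt) (fgn_autocov_decr 1 H_gt H_lt).
  rewrite fgn_autocov0// fgn_autocov1// mul1r /fgn_autocov.
  have -> : 3%:R + 1 = 4 :> R by ring.
  have -> : 3%:R - 1 = 2 :> R by ring.
  have -> : 2%:R + 1 = 3 :> R by ring.
  have -> : 2%:R - 1 = 1 :> R by ring.
  rewrite normr1 powR1 !ger0_norm//.
  have -> : 4 `^ (2 * H) = (2 `^ (2 * H)) ^+ 2 :> R.
    by rewrite expr2 -powRM//; congr (_ `^ _); ring.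
  by set u := 2 `^ _; set v := 3 `^ _; nra.
pose rho := fgn_autocov H.
(* [l] minimises the quadratic [l ^+ 2 * rho k.+1 - 2 * l * rho k.+2 + rho k.+3]. *)
set l := rho k.+2 / rho k.+1.
have := @fgn_autocov_comb_gt0 _ H (l ^+ 2) (- (2 * l)) 1 k.+1 H_gt isT.
have r0 := fgn_autocov_gt0 k.+1 H_gt.
have -> : l ^+ 2 * fgn_autocov H k.+1 + - (2 * l) * fgn_autocov H k.+2 +
   1 * fgn_autocov H k.+3 = (rho k.+1 * rho k.+3 - rho k.+2 ^+ 2) / rho k.+1.
  by rewrite /l /rho; field; rewrite gt_eqF.
rewrite pmulr_lgt0 ?invr_gt0// subr_gt0; apply => p p0.
have p1 : 0 < p + 1 by lra.
have p2 : 0 < p + 2 by lra.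
set b := 2 * H - 2.
(* Here p (p + 2) < (p + 1)^2, and the negative exponent [b] reverses the order. *)
have pq : ((p + 1) `^ b) ^+ 2 < p `^ b * (p + 2) `^ b.
  rewrite expr2 -!powRM ?ltW//; apply: ltr_npowR.
  - by rewrite /b; lra.
  - by rewrite mulr_gt0.
  - by nra.
have := powR_gt0 b p0.
move: pq; set u := p `^ b; set v := _ `^ b; set w := _ `^ b => pq u0.
(* Multiplying by [u] allows completing the square. *)
rewrite -(pmulr_rgt0 _ u0).
have -> : u * (l ^+ 2 * u + - (2 * l) * v + 1 * w) =
  (l * u - v) ^+ 2 + (u * w - v ^+ 2) by ring.
by rewrite ltr_wpDl ?sqr_ge0// subr_gt0.
Qed.

Theorem corollary2p6 (R : realType) (H : R)
  (H_gt : 2^-1 < H) (H_lt : H < 1) :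
  let rho := fgn_autocov H in
  [/\ forall k : nat, (1 <= k)%N -> rho (k - 1)%N > rho k /\ rho k > 0,
      forall k : nat, (1 <= k)%N ->
        rho (k - 1)%N - rho k > rho k - rho (k + 1)%N
    & forall k : nat, (1 <= k)%N ->
        rho (k - 1)%N * rho (k + 1)%N > rho k ^+ 2].
Proof.
move=> rho; split=> -[//|k] _; rewrite subn1 ?addn1 /=.
- by split; [exact: fgn_autocov_decr|exact: fgn_autocov_gt0].
- have x0 : 0 < rho k by exact: fgn_autocov_gt0.
  have z0 : 0 < rho k.+2 by exact: fgn_autocov_gt0.
  have y0 : 0 < rho k.+1 by exact: fgn_autocov_gt0.
  have : rho k.+1 ^+ 2 < rho k * rho k.+2 by exact: fgn_autocov_logconvex.
  move: (rho k) (rho k.+1) (rho k.+2) x0 y0 z0 => x y z x0 y0 z0 xyz.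
  (* AM-GM: (x + z)^2 >= 4 x z > 4 y^2, and dividing the difference of squares by [2 * y + (x + z)]
     leaves x + z > 2 y. *)
  have s0 : 0 < 2 * y + (x + z) by lra.
  have := sqr_ge0 (x - z); rewrite -subr_gt0 -(pmulr_rgt0 _ s0); nra.
- exact: fgn_autocov_logconvex.
Qed.
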